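(* For any $n\in\mathbb{N}=\{1,2,\dots\}$, the isospectral deformation $s\mapsto\gamma_n(s)$, $s\in\mathbb{R}$, of the zero potential, given by $$\gamma_n(s)(x)=-2\,\partial_x^2\log\theta_n(x;s),\qquad \theta_n(x;s)=1+(e^s-1)\int_x^1 2(\sin(n\pi r))^2\,dr,\quad x\in[0,1],$$ is not an isoheat deformation; that is, it is not the case that $Q_{\gamma_n(s)}(t)=Q_{\gamma_n(0)}(t)$ for all $s\in\mathbb{R}$ and all $t>0$.
   Context: For $q\in L^2[0,1]$ let $L_q=-\frac{d^2}{dx^2}+q$ act in $L^2[0,1]$ with Dirichlet boundary conditions at $0$ and $1$. It has discrete spectrum with simple eigenvalues $\lambda_1(q)<\lambda_2(q)<\cdots$; let $\phi_{j,q}$ be the eigenfunction for $\lambda_j(q)$ normalized by $\int_0^1\phi_{j,q}(x)^2dx=1$ and $\phi_{j,q}'(0)>0$. The heat content of $L_q$ is $$Q_q(t)=\sum_{j=1}^{\infty}e^{-t\lambda_j(q)}\left(\int_0^1\phi_{j,q}(x)\,dx\right)^2,\quad t>0.$$ Potentials $q_1,q_2\in L^2[0,1]$ are isospectral if $\lambda_j(q_1)=\lambda_j(q_2)$ for all $j$, and isoheat if $Q_{q_1}(t)=Q_{q_2}(t)$ for all $t>0$. The curve $\gamma_n$ is the solution of $\frac{d}{ds}\gamma_n(s)=X_n(\gamma_n(s))$, $\gamma_n(0)=0$, for the vector field $X_n(q)=2\frac{d}{dx}(\phi_{n,q})^2$; it is known (Pöschel–Trubowitz) that this solution is given by the formula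 in the claim and that $\gamma_n(s)$ is isospectral to the zero potential for every $s\in\mathbb{R}$. *)

(* Defs.v *)
(* MathComp-Analysis *)
From mathcomp Require Import all_boot all_order all_algebra.
From mathcomp Require Import all_classical all_reals all_analysis.

Set Implicit Arguments.
Unset Strict Implicit.
Unset Printing Implicit Defensive.
Import Order.TTheory GRing.Theory Num.Theory.
Import numFieldNormedType.Exports.

Local Open Scope classical_set_scope.
Local Open Scope ring_scope.

(* Functions on [0, 1] are represented by functions R -> R whose values
   outside [0, 1] are irrelevant. *)

Definition L2 (R : realType) (f : R -> R) : Prop :=
  measurable_fun `[(0 : R), 1] f /\
  lebesgue_measure.-integrable `[(0 : R), 1] (fun x => (f x ^+ 2)%:E).

(* u is absolutely continuous on [0, 1] with a.e. derivative v. *)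
Definition is_primitive (R : realType) (u v : R -> R) : Prop :=
  lebesgue_measure.-integrable `[(0 : R), 1] (EFin \o v) /\
  forall x : R, x \in `[0, 1] ->
    u x = u 0 + \int[lebesgue_measure]_(r in `[(0 : R), x]) v r.

(* Graph of L_q, for q in L^2[0, 1]: u lies in the domain H^2 /\ H^1_0 and
   L_q u = f. Elements u of the domain are given by their continuous
   representative. *)
Definition schrodinger (R : realType) (q u f : R -> R) : Prop :=
  exists du ddu : R -> R,
    [/\ is_primitive u du, is_primitive du ddu & L2 ddu] /\
    [/\ u 0 = 0, u 1 = 0
      & {ae lebesgue_measure, forall x : R, x \in `[0, 1] ->
          f x = - ddu x + q x * u x}].

Definition dirichlet_eigenvalue (R : realType) (q : R -> R) (l : R) : Prop :=
  exists u : R -> R, schrodinger q u (fun x => l * u x) /\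
    exists2 x : R, x \in `[0, 1] & u x != 0.

Definition is_spectrum (R : realType) (q : R -> R) (l : nat -> R) : Prop :=
  {homo l : i j / (i < j)%N >-> i < j} /\
  range l = [set x | dirichlet_eigenvalue q x].

(* Indices start at 0: [lambda q j] is the (j+1)-st eigenvalue of L_q, and
   [phi q j] below is the (j+1)-st eigenfunction. *)
Definition lambda (R : realType) (q : R -> R) : nat -> R :=
  xget (fun=> 0) [set l | is_spectrum q l].

Definition is_normalized_eigenfunction (R : realType) (q : R -> R) (l : R)
    (u : R -> R) : Prop :=
  [/\ schrodinger q u (fun x => l * u x),
      \int[lebesgue_measure]_(x in `[(0 : R), 1]) (u x ^+ 2) = 1
    & exists2 d : R, 0 < d & h^-1 * (u h - u 0) @[h --> 0^'+] --> d].

Definition phi (R : realType) (q : R -> R) (j : nat) : R -> R :=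
  xget (fun=> 0) [set u | is_normalized_eigenfunction q (lambda q j) u].

Definition heat_content (R : realType) (q : R -> R) (t : R) : R :=
  limn (series (fun j =>
    expR (- t * lambda q j) *
    (\int[lebesgue_measure]_(x in `[(0 : R), 1]) phi q j x) ^+ 2)).

Definition isoheat (R : realType) (q1 q2 : R -> R) : Prop :=
  forall t : R, 0 < t -> heat_content q1 t = heat_content q2 t.

Definition theta (R : realType) (n : nat) (s x : R) : R :=
  1 + (expR s - 1) *
    \int[lebesgue_measure]_(r in `[x, 1]) (2 * sin (n%:R * pi * r) ^+ 2).

(* For x > 1 the integral in theta is over the empty set, so theta n s x = 1;
   since sin (n pi) = 0, theta n s is still C^2 on the whole line and the
   two-sided derivatives at 0 and 1 agree with the one-sided ones. *)
Definition gamma (R : realType) (n : nat) (s : R) : R -> R :=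
  fun x => - 2 * derive1n 2 (fun y => ln (theta n s y)) x.

(* Main.v *)
(* For [s >= 0] let [T] be the restriction of [theta n s] to [0, 1], [E = e^s]
   and [S x = sin (n pi x)]. The double commutation transform
   [u |-> u - 2 (E - 1) S \int_0^x u S / T] sends Dirichlet solutions for the
   potential [gamma n s] to Dirichlet solutions for the potential 0 with the
   same eigenvalue, and it can be inverted explicitly. Hence the eigenvalues of
   [gamma n s] are the [(m pi)^2], with eigenfunctions [sol n E m], and the one
   for [m = n] is proportional to [S / T], with [\int (S / T)^2 = 1 / (2 E)].
   The coefficients of the Dirichlet series defining the heat content lie in
   [0, 1] and are determined by its sum, so an isoheat deformation would make
   [2 E (\int S / T)^2] independent of [s]. If [n] is odd, this quantity is
   positive at [s = 0] and tends to 0 as [s] grows, because the normalized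
   eigenfunction concentrates at 1. If [n] is even, it vanishes at [s = 0] but
   not for [s > 0], since an integration by parts gives
   [\int S / T = - \int (1 - cos (n pi x)) / (n pi) (1 / T)' dx < 0]. *)
Require Import Defs.
From mathcomp Require Import all_boot all_order all_algebra.
From mathcomp Require Import all_classical all_reals all_analysis.
From mathcomp Require Import measurable_realfun ring lra.

Set Implicit Arguments.
Unset Strict Implicit.
Unset Printing Implicit Defensive.
Import Order.TTheory GRing.Theory Num.Theory.
Import numFieldNormedType.Exports.

Local Open Scope classical_set_scope.
Local Open Scope ring_scope.

Local Notation mu := lebesgue_measure.

(** * Differentiation and integration on the unit interval *)

Section UnitInterval.
Context {R : realType}.
Implicit Types (f g : R -> R) (x : R).

Definition cont01 f := {within `[(0 : R), 1], continuous f}.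

(** The derivative is required only inside the interval because [gamma n s] is compared with its
    formula only there. Continuity up to the endpoints is enough for the mean value theorem. *)
Definition diff01 f f' :=
  cont01 f /\ forall x, x \in `]0, 1[ -> is_derive x 1 f (f' x).

Lemma in01 x : x \in `]0, 1[ -> x \in `[0, 1].
Proof. exact: subset_itv_oo_cc. Qed.

Lemma cont01D f g : cont01 f -> cont01 g -> cont01 (fun x => f x + g x).
Proof. by move=> cf cg x; apply: cvgD; [exact: cf | exact: cg]. Qed.

Lemma cont01B f g : cont01 f -> cont01 g -> cont01 (fun x => f x - g x).
Proof. by move=> cf cg x; apply: cvgB; [exact: cf | exact: cg]. Qed.

Lemma cont01M f g : cont01 f -> cont01 g -> cont01 (fun x => f x * g x).
Proof. by move=> cf cg x; apply: cvgM; [exact: cf | exact: cg]. Qed.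

Lemma cont01_cst (c : R) : cont01 (fun=> c).
Proof. by move=> x; exact: cvg_cst. Qed.

Lemma cont01_continuous f : {in `[0, 1], continuous f} -> cont01 f.
Proof.
by move=> cf; apply: continuous_in_subspaceT => x /[!inE]; exact: cf.
Qed.

Lemma cont01_eq f g : {in `[0, 1], f =1 g} -> cont01 f -> cont01 g.
Proof.
move=> fg; apply: subspace_eq_continuous => x x01; apply: fg.
by move: x01; rewrite inE.
Qed.

Lemma diff01_eqr f f' g' : {in `]0, 1[, f' =1 g'} -> diff01 f f' -> diff01 f g'.
Proof. by move=> e [cf df]; split=> // x x01; rewrite -e//; exact: df. Qed.

Lemma near01 x (P : R -> Prop) :
  x \in `]0, 1[ -> (forall y, y \in `]0, 1[ -> P y) -> \forall y \near x, P y.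
Proof. by move=> x01 H; near=> y; apply: H; near: y; exact: near_in_itvoo.
Unshelve. all: by end_near. Qed.

Lemma diff01_eql f g f' : {in `[0, 1], f =1 g} -> diff01 f f' -> diff01 g f'.
Proof.
move=> fg [cf df]; split=> [|x x01]; first exact: cont01_eq fg cf.
apply: near_eq_is_derive (df _ x01).
by apply: (near01 x01) => y /in01; exact: fg.
Qed.

Lemma diff01_everywhere f f' :
  (forall x, x \in `[0, 1] -> is_derive x 1 f (f' x)) -> diff01 f f'.
Proof.
move=> df; split=> [|x /in01]; last exact: df.
apply: cont01_continuous => x /df xf.
exact/differentiable_continuous/derivable1_diffP.
Qed.

Lemma diff01D f f' g g' : diff01 f f' -> diff01 g g' ->
  diff01 (fun x => f x + g x) (fun x => f' x + g' x).
Proof.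
move=> [cf df] [cg dg]; split=> [|x x01]; first exact: cont01D.
by have fx := df _ x01; have gx := dg _ x01; exact: is_deriveD.
Qed.

Lemma diff01B f f' g g' : diff01 f f' -> diff01 g g' ->
  diff01 (fun x => f x - g x) (fun x => f' x - g' x).
Proof.
move=> [cf df] [cg dg]; split=> [|x x01]; first exact: cont01B.
by have fx := df _ x01; have gx := dg _ x01; exact: is_deriveB.
Qed.

Lemma diff01M f f' g g' : diff01 f f' -> diff01 g g' ->
  diff01 (fun x => f x * g x) (fun x => f' x * g x + f x * g' x).
Proof.
move=> [cf df] [cg dg]; split=> [|x x01]; first exact: cont01M.
have fx := df _ x01; have gx := dg _ x01.
apply: (is_derive_eq (is_deriveM fx gx)).
by rewrite addrC /GRing.scale /=; congr (_ + _); rewrite mulrC.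
Qed.

Lemma diff01_cst (c : R) : diff01 (fun=> c) (fun=> 0).
Proof. by apply: diff01_everywhere => x _; exact: is_derive_cst. Qed.

Lemma diff01Z (c : R) f f' :
  diff01 f f' -> diff01 (fun x => c * f x) (fun x => c * f' x).
Proof.
move=> df; have := diff01M (diff01_cst c) df.
by apply: diff01_eqr => x _; rewrite mul0r add0r.
Qed.

Lemma diff01_incr_in f f' x y : diff01 f f' -> 0 <= x -> x <= y -> y <= 1 ->
  (forall z, z \in `]x, y[ -> 0 <= f' z) -> f x <= f y.
Proof.
move=> [cf df] x0; rewrite le_eqVlt => /predU1P[->//|xy] y1 f'0.
have xy01 z : z \in `]x, y[ -> z \in `]0, 1[.
  by rewrite !in_itv/= => /andP[/(le_lt_trans x0)-> /lt_le_trans->].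
have cfxy : {within `[x, y], continuous f}.
  apply: continuous_subspaceW cf => z /=; rewrite !in_itv/= => /andP[xz zy].
  by rewrite (le_trans x0)// (le_trans zy).
have [z zxy e] := MVT xy (fun z zxy => df z (xy01 z zxy)) cfxy.
by rewrite -subr_ge0 e mulr_ge0 ?subr_ge0 ?(ltW xy)//; exact: f'0.
Qed.

Lemma diff01_incr f f' x y : diff01 f f' ->
  (forall z, z \in `]0, 1[ -> 0 <= f' z) ->
  0 <= x -> x <= y -> y <= 1 -> f x <= f y.
Proof.
move=> df f'0 x0 xy y1; apply: (diff01_incr_in df) => // z zxy; apply: f'0.
by move: zxy; rewrite !in_itv/= => /andP[/(le_lt_trans x0)-> /lt_le_trans->].
Qed.

(** Both [f] and [- f] are nondecreasing. The identities below are obtained this way: a quantity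
    with zero derivative is evaluated at 0. *)
Lemma diff01_cst_eq f f' : diff01 f f' -> {in `]0, 1[, f' =1 cst 0} ->
  {in `[0, 1], f =1 cst (f 0)}.
Proof.
move=> df f'0 x /[!in_itv]/= /andP[x0 x1]; apply/eqP; rewrite eq_le /=.
have dN := diff01Z (-1) df; apply/andP; split.
  rewrite -lerN2 -![- f _]mulN1r; apply: (diff01_incr dN) => // z /f'0 ->.
  by rewrite mulr0.
by apply: (diff01_incr df) => // z /f'0 ->.
Qed.

Lemma cont01_integrable f :
  cont01 f -> mu.-integrable `[(0 : R), 1] (EFin \o f).
Proof. by apply: continuous_compact_integrable; exact: segment_compact. Qed.

Lemma Rintegral_diff01 f f' x y : diff01 f f' -> cont01 f' ->
  0 <= x -> x <= y -> y <= 1 ->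
  \int[mu]_(r in `[x, y]) f' r = f y - f x.
Proof.
move=> [cf df] cf' x0; rewrite le_eqVlt => /predU1P[<-|xy] y1.
  by rewrite set_itv1 Rintegral_set1 subrr.
have sub01 : `[x, y] `<=` `[(0 : R), 1].
  by move=> z /=; rewrite !in_itv/= => /andP[/(le_trans x0)-> /le_trans->].
have xy01 z : z \in `]x, y[ -> z \in `]0, 1[.
  by rewrite !in_itv/= => /andP[/(le_lt_trans x0)-> /lt_le_trans->].
rewrite /Rintegral (@continuous_FTC2 _ f' f)//.
- exact: continuous_subspaceW cf'.
- have /(continuous_within_itvP _ xy)[_ cr cl] := continuous_subspaceW sub01 cf.
  by split=> // z /xy01 /df [].
- by move=> z /xy01 /df H; rewrite derive1E derive_val.
Qed.

Lemma diff01_primitive f : cont01 f ->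
  diff01 (fun x => \int[mu]_(r in `[0, x]) f r) f.
Proof.
move=> cf; have fi := cont01_integrable cf; split.
  exact: (@parameterized_integral_continuous R 0 1 f ler01 fi).
move=> x x01; have /[!in_itv]/= /andP[x0 x1] := x01.
have cfx : {for x, continuous f}.
  exact: within_continuous_continuous cf x01.
have [dx ex] := continuous_FTC1_closed x1 fi x0 cfx.
by rewrite derive1E in ex; exact: DeriveDef dx ex.
Qed.

End UnitInterval.

Arguments cont01_cst {R} c.
Arguments cont01_eq {R f g}.
Arguments cont01D {R f g}.
Arguments cont01B {R f g}.
Arguments cont01M {R f g}.

(** * The free problem *)

Section Trigonometry.
Context {R : realType}.
Implicit Types (m n : nat) (x : R).

Definition freq m : R := m%:R * pi.

Lemma freq_gt0 m : (0 < m)%N -> 0 < freq m.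
Proof. by move=> m0; rewrite mulr_gt0 ?pi_gt0// ltr0n. Qed.

Lemma freq_inj : injective freq.
Proof.
by move=> m n /mulIf -/(_ (lt0r_neq0 (pi_gt0 R)))/eqP; rewrite eqr_nat => /eqP.
Qed.

Lemma sin_freq m : sin (freq m) = 0.
Proof.
elim: m => [|m IH]; first by rewrite /freq mul0r sin0.
by rewrite /freq -natr1 mulrDl mul1r sinDpi IH oppr0.
Qed.

Lemma cos_freq m : cos (freq m) = (-1) ^+ m.
Proof.
elim: m => [|m IH]; first by rewrite /freq mul0r cos0.
by rewrite /freq -natr1 mulrDl mul1r cosDpi IH exprS mulN1r.
Qed.

(** Subtracting the largest [freq k] not above [x] leaves a remainder in [0, pi), where [sin]
    vanishes only at 0; [0 < x] rules out [k = 0]. *)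
Lemma sin_eq0_freq x : 0 < x -> sin x = 0 -> exists m, x = freq m.+1.
Proof.
move=> x0 sx.
have p0 := pi_gt0 R.
have /truncn_itv/andP[] : 0 <= x / pi by rewrite divr_ge0// ltW.
set k := Num.truncn _; rewrite ler_pdivlMr// ltr_pdivrMr// => kx xk.
have rE : x = freq k.
  apply/eqP; rewrite -subr_eq0 eq_le; apply/andP.
  split; last by rewrite subr_ge0.
  rewrite leNgt; apply/negP => r0.
  have : sin (x - freq k) = 0 by rewrite sinB sx sin_freq mul0r mulr0 subrr.
  apply/eqP/lt0r_neq0/sin_gt0_pi; rewrite r0 /= ltrBlDl /freq.
  by rewrite -{2}[pi]mul1r -mulrDl natr1.
case: k rE {kx xk} => [|k] rE; last by exists k.
by move: x0; rewrite rE /freq mul0r ltxx.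
Qed.

Definition sn m x : R := sin (freq m * x).
Definition cs m x : R := cos (freq m * x).

Lemma is_derive_scale (a : R) x : is_derive x 1 (fun y => a * y) a.
Proof.
apply: (is_derive_eq (is_deriveM (is_derive_cst a x 1) (is_derive_id x 1))).
by rewrite /GRing.scale /= mulr0 addr0 mulr1.
Qed.

Lemma is_derive_sin_scale (a : R) x :
  is_derive x 1 (fun y => sin (a * y)) (a * cos (a * x)).
Proof.
apply: (is_derive_eq
  (is_derive1_comp (is_derive_sin (a * x)) (is_derive_scale a x))).
by rewrite mulrC.
Qed.

Lemma is_derive_cos_scale (a : R) x :
  is_derive x 1 (fun y => cos (a * y)) (- (a * sin (a * x))).
Proof.
apply: (is_derive_eq
  (is_derive1_comp (is_derive_cos (a * x)) (is_derive_scale a x))).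
by rewrite mulNr mulrC.
Qed.

Lemma is_derive_sn m x : is_derive x 1 (sn m) (freq m * cs m x).
Proof. exact: is_derive_sin_scale. Qed.

Lemma is_derive_cs m x : is_derive x 1 (cs m) (- (freq m * sn m x)).
Proof. exact: is_derive_cos_scale. Qed.

Lemma diff01_sn m : diff01 (sn m) (fun x => freq m * cs m x).
Proof. by apply: diff01_everywhere => x _; exact: is_derive_sn. Qed.

Lemma diff01_cs m : diff01 (cs m) (fun x => - (freq m * sn m x)).
Proof. by apply: diff01_everywhere => x _; exact: is_derive_cs. Qed.

Lemma sn0 m : sn m 0 = 0. Proof. by rewrite /sn mulr0 sin0. Qed.
Lemma cs0 m : cs m 0 = 1. Proof. by rewrite /cs mulr0 cos0. Qed.
Lemma sn1 m : sn m 1 = 0. Proof. by rewrite /sn mulr1 sin_freq. Qed.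
Lemma cs2Dsn2 m x : cs m x ^+ 2 + sn m x ^+ 2 = 1.
Proof. exact: cos2Dsin2. Qed.

Lemma is_derive_mul (f g : R -> R) x (a b : R) :
  is_derive x 1 f a -> is_derive x 1 g b ->
  is_derive x 1 (fun y => f y * g y) (a * g x + f x * b).
Proof.
move=> fx gx; apply: (is_derive_eq (is_deriveM fx gx)).
by rewrite addrC /GRing.scale /=; congr (_ + _); rewrite mulrC.
Qed.

Lemma is_derive_sub (f g : R -> R) x (a b : R) :
  is_derive x 1 f a -> is_derive x 1 g b ->
  is_derive x 1 (fun y => f y - g y) (a - b).
Proof. by move=> fx gx; exact: is_deriveB. Qed.

Lemma is_derive_add (f g : R -> R) x (a b : R) :
  is_derive x 1 f a -> is_derive x 1 g b ->
  is_derive x 1 (fun y => f y + g y) (a + b).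
Proof. by move=> fx gx; exact: is_deriveD. Qed.

Lemma is_derive_scalel (c : R) (f : R -> R) x (a : R) :
  is_derive x 1 f a -> is_derive x 1 (fun y => c * f y) (c * a).
Proof.
move=> fx; apply: (is_derive_eq (is_derive_mul (is_derive_cst c x 1) fx)).
by rewrite mul0r add0r.
Qed.

End Trigonometry.
Arguments freq {R}.

Section FreeProblem.
Context {R : realType}.
Variables (v dv : R -> R) (l : R).
Hypotheses (vD : diff01 v dv) (dvD : diff01 dv (fun x => - l * v x)).
Hypotheses (v0 : v 0 = 0) (v1 : v 1 = 0).

(** The product [v * dv] has derivative [dv ^+ 2 - l * v ^+ 2 >= 0] and vanishes at both ends, so it
    is zero. Hence [v ^+ 2] is constant, equal to its value 0 at the origin. *)
Lemma free_dirichlet_nonpos : l <= 0 -> {in `[0, 1], v =1 cst 0}.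
Proof.
move=> l0.
have vdv x : x \in `]0, 1[ -> v x * dv x = 0.
  move=> /in01 /[!in_itv]/= /andP[x0 x1].
  have D := diff01M vD dvD.
  have D_ge0 z : z \in `](0 : R), 1[ -> 0 <= dv z * dv z + v z * (- l * v z).
    move=> _; rewrite addr_ge0 ?sqr_ge0//.
    by rewrite mulrCA mulr_ge0 ?sqr_ge0// oppr_ge0.
  apply/eqP; rewrite eq_le; apply/andP; split.
    have := diff01_incr D D_ge0 x0 x1 (lexx _).
    by rewrite v1 mul0r.
  have := diff01_incr D D_ge0 (lexx _) x0 x1.
  by rewrite v0 mul0r.
move=> x x01; apply/eqP; rewrite -[_ == _]orbb -mulf_eq0.
rewrite (diff01_cst_eq (diff01M vD vD) _ x01) ?v0 ?mul0r// => z z01 /=.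
by rewrite [dv z * _]mulrC vdv// addr0.
Qed.

(** Rotating the vector [(v, dv / w)] by the angle [w * x] yields two conserved quantities,
    evaluated in [A] and [B]; rotating back recovers [v]. *)
Lemma free_dirichlet_pos w : 0 < w -> l = w ^+ 2 ->
  {in `[0, 1], forall x, v x = dv 0 / w * sin (w * x)}.
Proof.
move=> w0 lw x x01; have wn0 := lt0r_neq0 w0.
have sD : diff01 (fun y => sin (w * y)) (fun y => w * cos (w * y)).
  by apply: diff01_everywhere => y _; exact: is_derive_sin_scale.
have cD : diff01 (fun y => cos (w * y)) (fun y => - (w * sin (w * y))).
  by apply: diff01_everywhere => y _; exact: is_derive_cos_scale.
have A : v x * cos (w * x) - w^-1 * (dv x * sin (w * x)) = 0.
  have D := diff01B (diff01M vD cD) (diff01Z w^-1 (diff01M dvD sD)).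
  rewrite (diff01_cst_eq D _ x01) /=.
    by rewrite v0 mulr0 sin0; ring.
  by move=> y _ /=; rewrite lw; field.
have B : v x * sin (w * x) + w^-1 * (dv x * cos (w * x)) = dv 0 / w.
  have D := diff01D (diff01M vD sD) (diff01Z w^-1 (diff01M dvD cD)).
  rewrite (diff01_cst_eq D _ x01) /=.
    by rewrite v0 mulr0 cos0; ring.
  by move=> y _ /=; rewrite lw; field.
rewrite -B -[LHS]mulr1 -(cos2Dsin2 (w * x)).
by rewrite -[LHS]addr0 -[in LHS](mul0r (- cos (w * x))) -A; ring.
Qed.

(** The alternative [a = 0] is the zero solution, which leaves [l] unconstrained. Otherwise [l > 0],
    and the condition at 1 makes the square root of [l] a zero of [sin]. *)
Lemma free_dirichlet : exists m a,
  {in `[0, 1], forall x, v x = a * sn m.+1 x} /\ (l = freq m.+1 ^+ 2 \/ a = 0).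
Proof.
have [l0|l0] := leP l 0.
  exists 0%N, 0; split; last by right.
  by move=> x /(free_dirichlet_nonpos l0) ->; rewrite mul0r.
have w0 : 0 < Num.sqrt l by rewrite sqrtr_gt0.
have lw : l = Num.sqrt l ^+ 2 by rewrite sqr_sqrtr// ltW.
have vE := free_dirichlet_pos w0 lw.
have := vE 1; rewrite in_itv/= ler01 lexx v1 mulr1 => /(_ isT)/esym/eqP.
rewrite mulf_eq0 => /orP[/eqP a0|/eqP /(sin_eq0_freq w0)[m wm]].
  exists 0%N, 0; split; last by right.
  by move=> x /vE ->; rewrite a0 !mul0r.
exists m, (dv 0 / Num.sqrt l); split; last by left; rewrite {1}lw wm.
by move=> x /vE ->; rewrite /sn -wm.
Qed.

End FreeProblem.

(** * The deformed potential and its solutions *)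

Section Deformation.
Context {R : realType}.
Implicit Types (m n : nat) (E x : R).

(* The primitive of [sn n * sn m] vanishing at 0; for [m <> n] it is a
   Wronskian divided by the difference of the eigenvalues. *)
Definition prim n m x : R :=
  if m == n then 2^-1 * (x - sn n x * cs n x / freq n) else
    (freq n * cs n x * sn m x - freq m * cs m x * sn n x)
      / (freq m ^+ 2 - freq n ^+ 2).

(* [tau n (expR s)] extends [theta n s] to a smooth function on the line. *)
Definition tau n E x : R := E - 2 * (E - 1) * prim n n x.

(* [- 2 * (ln \o tau n E)''] *)
Definition pot n E x : R :=
  8 * (E - 1) * (freq n * cs n x * sn n x) / tau n E x
  + 8 * (E - 1) ^+ 2 * sn n x ^+ 4 / tau n E x ^+ 2.

(** The double commutation image of [sn m]. For [m = n] it reduces to [E * sn n / tau n E] wherever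
    [tau n E] is nonzero. *)
Definition sol n E m x : R :=
  sn m x + 2 * (E - 1) * (sn n x * prim n m x / tau n E x).

Definition dsol n E m x : R :=
  freq m * cs m x + 2 * (E - 1) *
   ((freq n * cs n x * prim n m x + sn n x * (sn n x * sn m x)) / tau n E x
    + sn n x * prim n m x * (2 * (E - 1) * sn n x ^+ 2 / tau n E x ^+ 2)).

Lemma freq_sqr_neq n m : m != n -> freq m ^+ 2 - freq n ^+ 2 != 0 :> R.
Proof.
move=> mn; rewrite subr_eq0 eqrXn2// ?mulr_ge0 ?pi_ge0//.
by rewrite (inj_eq freq_inj).
Qed.

Section Fixed.
Variables (n : nat) (n0 : (0 < n)%N).

Let wn0 : freq n != 0 :> R. Proof. exact/lt0r_neq0/freq_gt0. Qed.

(** Stated without division so as to cover [m = n] as well, where both sides vanish; the check of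
    the deformed equation then needs no case split. *)
Lemma prim_wronskian m x :
  (freq m ^+ 2 - freq n ^+ 2) * prim n m x =
  freq n * cs n x * sn m x - freq m * cs m x * sn n x.
Proof.
rewrite /prim; have [->|/freq_sqr_neq mn] := eqVneq m n.
  by rewrite subrr mul0r subrr.
by rewrite mulrC divfK.
Qed.

Lemma is_derive_prim m x : is_derive x 1 (prim n m) (sn n x * sn m x).
Proof.
have sD := is_derive_sn; have cD := is_derive_cs.
rewrite /prim; case: eqP => [->|/eqP/freq_sqr_neq mn].
  have D := is_derive_scalel (freq n)^-1 (is_derive_mul (sD R n x) (cD R n x)).
  have {}D := is_derive_scalel 2^-1 (is_derive_sub (is_derive_id x 1) D).
  rewrite [X in is_derive _ _ X](_ : _ =
     fun y => 2^-1 * (y - (freq n)^-1 * (sn n y * cs n y))); last first.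
    by apply/funext => y; rewrite [_ / _]mulrC.
  apply: (is_derive_eq D).
  have c2 : cs n x ^+ 2 = 1 - sn n x ^+ 2 by rewrite -(cs2Dsn2 n x) addrK.
  transitivity (2^-1 * (1 - cs n x ^+ 2 + sn n x ^+ 2)); first by field.
  by rewrite c2; field.
have D := is_derive_sub
  (is_derive_scalel (freq n) (is_derive_mul (cD R n x) (sD R m x)))
  (is_derive_scalel (freq m) (is_derive_mul (cD R m x) (sD R n x))).
have {}D := is_derive_scalel (freq m ^+ 2 - freq n ^+ 2)^-1 D.
rewrite [X in is_derive _ _ X](_ : _ = fun y => (freq m ^+ 2 - freq n ^+ 2)^-1 *
   (freq n * (cs n y * sn m y) - freq m * (cs m y * sn n y))); last first.
  by apply/funext => y; rewrite [_ / _]mulrC !mulrA.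
by apply: (is_derive_eq D); field.
Qed.

Lemma prim0 m : prim n m 0 = 0.
Proof.
by rewrite /prim !sn0; case: eqP => _; rewrite ?(mul0r, mulr0, subrr).
Qed.

Lemma prim1 : prim n n 1 = 2^-1.
Proof. by rewrite /prim eqxx sn1 !mul0r subr0 mulr1. Qed.

Lemma diff01_prim m : diff01 (prim n m) (fun x => sn n x * sn m x).
Proof. by apply: diff01_everywhere => x _; exact: is_derive_prim. Qed.

Lemma prim_incr x y : 0 <= x -> x <= y -> y <= 1 -> prim n n x <= prim n n y.
Proof.
by apply: (diff01_incr (diff01_prim n)) => z _; exact: sqr_ge0.
Qed.

Lemma is_derive_tau E x :
  is_derive x 1 (tau n E) (- (2 * (E - 1) * sn n x ^+ 2)).
Proof.
have D := is_derive_scalel (2 * (E - 1)) (is_derive_prim n x).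
by apply: (is_derive_eq (is_derive_sub (is_derive_cst E x 1) D)); ring.
Qed.

Lemma tau0 E : tau n E 0 = E.
Proof. by rewrite /tau prim0 mulr0 subr0. Qed.

Lemma tau1 E : tau n E 1 = 1.
Proof. by rewrite /tau prim1; field. Qed.

Lemma tau_decr E x y : 1 <= E -> 0 <= x -> x <= y -> y <= 1 ->
  tau n E y <= tau n E x.
Proof.
move=> E1 x0 xy y1; rewrite lerD2l lerN2 ler_wpM2l ?prim_incr//.
by rewrite mulr_ge0// subr_ge0.
Qed.

(** For [1 <= E] the function [tau n E] decreases from [E] to 1. Division by [tau] on the interval
    rests on this bound, whence the restriction to [s >= 0] later. *)
Lemma tau_ge1 E x : 1 <= E -> x \in `[0, 1] -> 1 <= tau n E x.
Proof.
move=> E1 /[!in_itv]/= /andP[x0 x1].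
by rewrite -(tau1 E) tau_decr.
Qed.

Lemma tau_gt0 E x : 1 <= E -> x \in `[0, 1] -> 0 < tau n E x.
Proof. by move=> E1 x01; exact/(lt_le_trans ltr01)/tau_ge1. Qed.

Lemma is_derive_tauV E x : tau n E x != 0 -> is_derive x 1
  (fun y => (tau n E y)^-1) (2 * (E - 1) * sn n x ^+ 2 / tau n E x ^+ 2).
Proof.
move=> t0; apply: (is_derive_eq (is_deriveV t0 (is_derive_tau E x))).
by rewrite /GRing.scale /=; field.
Qed.

Lemma diff01_tauV E : 1 <= E -> diff01 (fun x => (tau n E x)^-1)
  (fun x => 2 * (E - 1) * sn n x ^+ 2 / tau n E x ^+ 2).
Proof.
move=> E1; apply: diff01_everywhere => x x01.
exact/is_derive_tauV/lt0r_neq0/tau_gt0.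
Qed.

(** An explicit primitive of the squared mode. Between 0 and 1 it gives the norm of the deformed
    [n]-th eigenfunction; between [1 - d] and 1 it gives an estimate near the endpoint. *)
Lemma diff01_prim_tauV E : 1 <= E ->
  diff01 (fun x => prim n n x / tau n E x)
         (fun x => E * (sn n x / tau n E x) ^+ 2).
Proof.
move=> E1; apply: diff01_eqr (diff01M (diff01_prim n) (diff01_tauV E1)).
move=> x /in01/(tau_gt0 E1)/lt0r_neq0 t0.
(* The numerator left by the product rule is the constant [E], by definition of [tau]. *)
transitivity ((tau n E x + 2 * (E - 1) * prim n n x)
  * (sn n x / tau n E x) ^+ 2); first by field.
by rewrite subrK.
Qed.

Lemma is_derive_sol E m x : tau n E x != 0 ->
  is_derive x 1 (sol n E m) (dsol n E m x).
Proof.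
move=> t0.
have D := is_derive_mul (is_derive_mul (is_derive_sn n x) (is_derive_prim m x))
  (is_derive_tauV t0).
have {}D := is_derive_add (is_derive_sn m x) (is_derive_scalel (2 * (E - 1)) D).
by apply: (is_derive_eq D).
Qed.

Lemma is_derive_dsol E m x : tau n E x != 0 -> is_derive x 1 (dsol n E m)
  ((pot n E x - freq m ^+ 2) * sol n E m x).
Proof.
move=> t0.
have S := @is_derive_sn R n x; have C := @is_derive_cs R n x.
have s := @is_derive_sn R m x; have c := @is_derive_cs R m x.
have K := is_derive_prim m x; have H := is_derive_tauV t0.
have D1 := is_derive_mul (is_derive_add
  (is_derive_mul (is_derive_scalel (freq n) C) K)
  (is_derive_mul S (is_derive_mul S s))) H.
have D2 := is_derive_mul (is_derive_mul S K) (is_derive_scalel (2 * (E - 1))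
  (is_derive_mul (is_derive_mul S S) (is_derive_mul H H))).
have D := is_derive_add (is_derive_scalel (freq m) c)
  (is_derive_scalel (2 * (E - 1)) (is_derive_add D1 D2)).
rewrite [X in is_derive _ _ X](_ : _ = fun y => freq m * cs m y + 2 * (E - 1) *
   ((freq n * cs n y * prim n m y + sn n y * (sn n y * sn m y)) * (tau n E y)^-1
    + sn n y * prim n m y * (2 * (E - 1) * (sn n y * sn n y *
        ((tau n E y)^-1 * (tau n E y)^-1))))); last first.
  by apply/funext => y; rewrite /dsol expr2 expr2 invfM !mulrA.
apply: (is_derive_eq D).
have W : (freq m ^+ 2 - freq n ^+ 2) * prim n m x -
  (freq n * cs n x * sn m x - freq m * cs m x * sn n x) = 0.
  by rewrite prim_wronskian subrr.
apply/eqP; rewrite -subr_eq0; apply/eqP.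
(* The two sides differ by [2 * (E - 1) * sn n x / tau n E x] times the Wronskian identity [W]; once
   this multiple is inserted, the goal is a rational identity. *)
rewrite -(mulr0 (2 * (E - 1) * sn n x * (tau n E x)^-1)) -W /pot /sol.
by field.
Qed.

End Fixed.
End Deformation.

(** * Every Dirichlet solution of the deformed equation is a multiple of some [sol] *)

Section DeformedProblem.
Context {R : realType}.
Variables (n : nat) (E l : R) (u du : R -> R).
Hypotheses (n0 : (0 < n)%N) (E1 : 1 <= E).
Hypotheses (uD : diff01 u du).
Hypotheses (duD : diff01 du (fun x => (pot n E x - l) * u x)).
Hypotheses (u0 : u 0 = 0) (u1 : u 1 = 0).

Let c := 2 * (E - 1).
Let T := tau n E.
Let Sn := @sn R n.
Let h x := (T x)^-1.
Let J x := \int[mu]_(r in `[0, x]) (u r * Sn r * h r).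

Let T0 x : x \in `[0, 1] -> T x != 0.
Proof. by move=> x01; exact/lt0r_neq0/tau_gt0. Qed.

Let SnD : diff01 Sn (fun x => freq n * cs n x). Proof. exact: diff01_sn. Qed.
Let csD : diff01 (cs n) (fun x => - (freq n * Sn x)).
Proof. exact: diff01_cs. Qed.

Let hD : diff01 h (fun x => c * Sn x ^+ 2 / T x ^+ 2).
Proof. exact: diff01_tauV. Qed.

Let TD : diff01 T (fun x => - (c * Sn x ^+ 2)).
Proof. by apply: diff01_everywhere => x _; exact: is_derive_tau. Qed.

Let JD : diff01 J (fun x => u x * Sn x * h x).
Proof.
apply: diff01_primitive; apply: cont01M; last by case: hD.
by apply: cont01M; [case: uD | case: SnD].
Qed.

Let J0 : J 0 = 0. Proof. by rewrite /J set_itv1 Rintegral_set1. Qed.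

(** The deformed mode of frequency [freq n]: on the interval [sol n E n] is [E * psi]. The function
    [dpsi] is its derivative. *)
Let psi x := Sn x * h x.
Let dpsi x := freq n * cs n x * h x + c * (Sn x * Sn x * Sn x * (h x * h x)).

Let psiD : diff01 psi dpsi.
Proof.
apply: diff01_eqr (diff01M SnD hD) => x x01.
by rewrite /dpsi /h; field; exact/T0/in01.
Qed.

Let dpsiD : diff01 dpsi (fun x => (pot n E x - freq n ^+ 2) * psi x).
Proof.
have D := diff01D (diff01M (diff01Z (freq n) csD) hD)
  (diff01Z c (diff01M (diff01M (diff01M SnD SnD) SnD) (diff01M hD hD))).
apply: diff01_eqr D => x x01; rewrite /psi /pot /h -/(T x) -/(Sn x) /c.
by field; exact/T0/in01.
Qed.

(** Since [u] and [psi] solve the same equation with eigenvalues [l] and [freq n ^+ 2], both sides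
    have derivative [(l - freq n ^+ 2) * u * psi], and both vanish at 0. *)
Lemma deformed_wronskian : {in `[0, 1], forall x,
  u x * dpsi x - du x * psi x = (l - freq n ^+ 2) * J x}.
Proof.
have D := diff01B (diff01B (diff01M uD dpsiD) (diff01M duD psiD))
  (diff01Z (l - freq n ^+ 2) JD).
move=> x x01; apply/eqP; rewrite -subr_eq0; apply/eqP.
rewrite (diff01_cst_eq D _ x01) /=; last by move=> y _ /=; rewrite /psi; ring.
by rewrite J0 u0 /psi /Sn sn0; ring.
Qed.

(* The inverse of the double commutation transform turns [u] into a solution
   of the free problem with the same eigenvalue. *)
Let v x := u x - c * (Sn x * J x).
Let dv x := du x - c * (freq n * cs n x * J x + Sn x * (u x * Sn x * h x)).

Let vD : diff01 v dv.
Proof. exact: diff01B uD (diff01Z c (diff01M SnD JD)). Qed.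

(** The free equation for [v] holds up to [c * Sn] times the defect in [deformed_wronskian], which
    is zero. *)
Let dvD : diff01 dv (fun x => - l * v x).
Proof.
have D := diff01B duD (diff01Z c (diff01D
  (diff01M (diff01Z (freq n) csD) JD)
  (diff01M SnD (diff01M (diff01M uD SnD) hD)))).
apply: diff01_eqr D => x x01.
have W := deformed_wronskian (in01 x01).
apply/eqP; rewrite -subr_eq0; apply/eqP.
transitivity (c * Sn x * (u x * dpsi x - du x * psi x
     - (l - freq n ^+ 2) * J x)); last by rewrite W subrr mulr0.
rewrite /v /dpsi /psi /pot /h -/(T x) -/(Sn x) /c.
by field; exact/T0/in01.
Qed.

(** The free problem gives [v = a * sn m.+1]. Then [J * T - a * prim n m.+1] has derivative
    [Sn * (v - a * sn m.+1) = 0], which determines [J], and [u = v + c * Sn * J] follows. *)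
Lemma deformed_dirichlet : exists m a,
  {in `[0, 1], forall x, u x = a * sol n E m.+1 x} /\
  (l = freq m.+1 ^+ 2 \/ a = 0).
Proof.
have v0 : v 0 = 0 by rewrite /v u0 J0 !mulr0 subrr.
have v1 : v 1 = 0 by rewrite /v u1 /Sn sn1 mul0r mulr0 subrr.
have [m [a [vE la]]] := free_dirichlet vD dvD v0 v1.
exists m, a; split=> // x x01.
have D := diff01B (diff01M JD TD) (diff01Z a (diff01_prim n0 m.+1)).
have JE : J x * T x - a * prim n m.+1 x = 0.
  rewrite (diff01_cst_eq D _ x01) /=; first by rewrite J0 prim0; ring.
  move=> y y01 /=; have := vE _ (in01 y01); rewrite /v /h => e.
  transitivity (Sn y * (u y - c * (Sn y * J y) - a * sn m.+1 y)).
    by rewrite -/(Sn y); field; exact/T0/in01.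
  by rewrite e subrr mulr0.
have {}JE : J x = a * prim n m.+1 x / T x.
  by move/eqP: JE; rewrite subr_eq0 => /eqP <-; rewrite mulfK// T0.
have := vE _ x01; rewrite /v JE => /eqP; rewrite subr_eq => /eqP ->.
by rewrite /sol -/(Sn x) -/(T x) -/c; ring.
Qed.

End DeformedProblem.

(** * Schrodinger equation with a continuous potential *)

Section ClassicalSolutions.
Context {R : realType}.
Variables (q p : R -> R).
Hypotheses (qp : {in `]0, 1[, q =1 p}) (cp : cont01 p).

(** The exceptional set consists of the two endpoints, where [q] is not controlled. *)
Lemma ae_eq_interior : {ae mu, forall x, x \in `[0, 1] -> q x = p x}.
Proof.
exists ([set 0] `|` [set 1]); split.
- by apply: measurableU; exact: measurable_set1.
- by rewrite measureU0//; exact: lebesgue_measure_set1.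
move=> x /=; apply: contra_notP => /not_orP[/eqP x0 /eqP x1].
rewrite in_itv/= => /andP[x0' x1']; apply: qp.
by rewrite in_itv/= !lt_neqAle x0' x1' eq_sym x0 x1.
Qed.

(** Regularity: [ddu] equals the continuous function [(p - l) * u] almost everywhere, so [du], being
    a primitive of either, is classically differentiable. *)
Lemma schrodinger_diff01 (l : R) (u : R -> R) :
  schrodinger q u (fun x => l * u x) ->
  exists du, [/\ diff01 u du, diff01 du (fun x => (p x - l) * u x),
    u 0 = 0 & u 1 = 0].
Proof.
move=> [du [ddu [[[_ uE] [iddu duE] _] [u0 u1 uq]]]]; exists du.
have cdu : cont01 du.
  have cI : cont01 (fun x => \int[mu]_(r in `[0, x]) ddu r).
    exact: (parameterized_integral_continuous ler01 iddu).
  have e : {in `[0, 1], (fun x => du 0 + \int[mu]_(r in `[0, x]) ddu r) =1 du}.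
    by move=> x /duE.
  exact: cont01_eq e (cont01D (cont01_cst (du 0)) cI).
have uD : diff01 u du.
  have := diff01D (diff01_cst (u 0)) (diff01_primitive cdu).
  move=> /(diff01_eqr (g' := du)) D.
  apply: diff01_eql (D _) => [x /uE -> //|x _].
  by rewrite add0r.
have cpu : cont01 (fun x => (p x - l) * u x).
  by apply: cont01M; [apply: cont01B => //; exact: cont01_cst | case: uD].
split=> //.
have := diff01D (diff01_cst (du 0)) (diff01_primitive cpu).
move=> /(diff01_eqr (g' := fun x => (p x - l) * u x)) D.
apply: diff01_eql (D _) => [x x01|x _]; last first.
  by rewrite add0r.
rewrite [RHS]duE//; congr (_ + fine _).
have sub : `[0, x] `<=` `[(0 : R), 1].
  by apply: subset_itvl; move: x01; rewrite in_itv/= bnd_simp => /andP[].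
apply: ae_eq_integral => //.
- by apply: measurable_funS (measurable_int mu (cont01_integrable cpu)).
- by apply: measurable_funS (measurable_int mu iddu).
near=> y => y0x.
have y01 : y \in `[0, 1] by exact: sub.
have : y \in `[0, 1] -> l * u y = - ddu y + q y * u y by near: y.
have -> : q y = p y by move: y01; near: y; exact: ae_eq_interior.
by move=> /(_ y01) e; congr EFin; rewrite mulrBl e; ring.
Unshelve. all: by end_near. Qed.

Lemma diff01_schrodinger (l : R) (u du : R -> R) :
  diff01 u du -> diff01 du (fun x => (p x - l) * u x) -> u 0 = 0 -> u 1 = 0 ->
  schrodinger q u (fun x => l * u x).
Proof.
move=> uD duD u0 u1; exists du, (fun x => (p x - l) * u x).
have cdu : cont01 du by case: duD.
have cpu : cont01 (fun x => (p x - l) * u x).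
  by apply: cont01M; [apply: cont01B => //; exact: cont01_cst | case: uD].
have primD f f' : diff01 f f' -> cont01 f' -> is_primitive f f'.
  move=> fD cf'; split; first exact: cont01_integrable.
  move=> x; rewrite in_itv/= => /andP[x0 x1].
  by rewrite (Rintegral_diff01 fD)// addrC subrK.
split.
  split; [exact: primD | exact: primD | split].
    exact: subspace_continuous_measurable_fun (measurable_itv _) cpu.
  exact: (cont01_integrable (cont01M cpu cpu)).
split=> //; have [N [mN N0 qN]] := ae_eq_interior; exists N; split=> //.
by apply: subset_trans qN; apply: subsetC => x qpx x01; rewrite qpx//; ring.
Qed.

End ClassicalSolutions.

Lemma is_derive_cvg_right0 (R : realType) (f : R -> R) (d : R) :
  is_derive (0 : R) 1 f d -> h^-1 * (f h - f 0) @[h --> 0^'+] --> d.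
Proof.
move=> [df <-]; apply: cvg_dnbhs_at_right.
move: df; rewrite /derivable /derive.
rewrite (_ : (fun h => _) = (fun h => h^-1 * (f h - f 0)))//.
by apply/funext => h /=; rewrite /GRing.scale /= mulr1 addr0.
Qed.

(** * The potential [gamma n s] for [s >= 0] and its Dirichlet solutions *)

Section Potential.
Context {R : realType}.
Variables (n : nat) (s : R).
Hypotheses (n0 : (0 < n)%N) (s0 : 0 <= s).

Let E1 : 1 <= expR s. Proof. by rewrite -expR0 ler_expR. Qed.

Lemma theta_tau x : x \in `[0, 1] -> theta n s x = tau n (expR s) x.
Proof.
rewrite in_itv/= => /andP[x0 x1].
have D := diff01Z 2 (@diff01_prim R n n0 n).
have [cD _] := diff01Z 2 (diff01M (@diff01_sn R n) (diff01_sn n)).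
rewrite /theta.
under eq_Rintegral do rewrite expr2 -/(freq n) -/(sn n _).
by rewrite (Rintegral_diff01 D cD x0 x1 (lexx _)) prim1// /tau; field.
Qed.

(** Agreement of [theta] with [tau] is known on the closed interval, so both derivatives are taken
    at interior points, where it holds in a neighbourhood. *)
Lemma gamma_pot : {in `]0, 1[, gamma n s =1 pot n (expR s)}.
Proof.
have T0 y : y \in `[0, 1] -> 0 < tau n (expR s) y by exact: tau_gt0.
have lnD (y : R) : y \in `]0, 1[ -> is_derive y 1 (fun z => ln (theta n s z))
    ((tau n (expR s) y)^-1 * - (2 * (expR s - 1) * sn n y ^+ 2)).
  move=> y01; have Ty := T0 _ (in01 y01).
  apply: near_eq_is_derive (is_derive1_comp (is_derive1_ln Ty)
    (is_derive_tau n0 (expR s) y)).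
  by apply: (near01 y01) => z /in01 z01 /=; rewrite theta_tau.
move=> x x01; have Tx := lt0r_neq0 (T0 _ (in01 x01)).
rewrite /gamma derive1nS derive1n1 derive1E.
have sD := is_derive_sn n x.
have D := is_derive_mul (is_derive_tauV n0 Tx)
  (is_derive_scalel (- (2 * (expR s - 1))) (is_derive_mul sD sD)).
have e : \forall y \near x, (tau n (expR s) y)^-1 *
    (- (2 * (expR s - 1)) * (sn n y * sn n y)) =
    derive1 (fun z => ln (theta n s z)) y.
  apply: (near01 x01) => y y01 /=; have yD := lnD _ y01.
  by rewrite derive1E derive_val expr2 mulNr.
have {}D := near_eq_is_derive e D.
by rewrite derive_val /pot; field.
Qed.

Lemma cont01_pot : cont01 (pot n (expR s)).
Proof.
have T0 y : y \in `[0, 1] -> tau n (expR s) y != 0.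
  by move=> y01; exact/lt0r_neq0/tau_gt0.
have [[cS _] [cC _]] := (@diff01_sn R n, @diff01_cs R n).
have [cT _] := diff01_tauV n0 E1.
have k c := @cont01_cst R c.
have c1 := cont01M (cont01M (k (8 * (expR s - 1)))
  (cont01M (cont01M (k (freq n)) cC) cS)) cT.
have c2 := cont01M (cont01M (k (8 * (expR s - 1) ^+ 2))
  (cont01M (cont01M cS cS) (cont01M cS cS))) (cont01M cT cT).
apply: cont01_eq (cont01D c1 c2) => x /T0 t0; rewrite /pot.
by field.
Qed.

Lemma diff01_sol m : diff01 (sol n (expR s) m) (dsol n (expR s) m).
Proof.
apply: diff01_everywhere => x x01; apply: is_derive_sol => //.
exact/lt0r_neq0/tau_gt0.
Qed.

Lemma sol0 m : sol n (expR s) m 0 = 0.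
Proof. by rewrite /sol !sn0; ring. Qed.

Lemma sol1 m : sol n (expR s) m 1 = 0.
Proof. by rewrite /sol !sn1; ring. Qed.

Lemma dsol0 m : dsol n (expR s) m 0 = freq m.
Proof. by rewrite /dsol !sn0 prim0 cs0; ring. Qed.

Lemma schrodinger_sol m (a : R) : schrodinger (gamma n s)
  (fun x => a * sol n (expR s) m x)
  (fun x => freq m ^+ 2 * (a * sol n (expR s) m x)).
Proof.
apply: (diff01_schrodinger gamma_pot cont01_pot (diff01Z a (diff01_sol m))).
- have : diff01 (dsol n (expR s) m)
    (fun x => (pot n (expR s) x - freq m ^+ 2) * sol n (expR s) m x).
    apply: diff01_everywhere => x x01; apply: is_derive_dsol => //.
    exact/lt0r_neq0/tau_gt0.
  by move=> /(diff01Z a); apply: diff01_eqr => x _; ring.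
- by rewrite sol0 mulr0.
- by rewrite sol1 mulr0.
Qed.

Lemma schrodinger_gamma (l : R) u :
  schrodinger (gamma n s) u (fun x => l * u x) ->
  exists m a, {in `[0, 1], forall x, u x = a * sol n (expR s) m.+1 x} /\
    (l = freq m.+1 ^+ 2 \/ a = 0).
Proof.
move=> /(schrodinger_diff01 gamma_pot cont01_pot)[du [uD duD u0 u1]].
exact: (deformed_dirichlet n0 E1 uD duD u0 u1).
Qed.

Lemma cvg_sol_right m (a : R) :
  h^-1 * (a * sol n (expR s) m h - a * sol n (expR s) m 0) @[h --> 0^'+]
    --> a * freq m.
Proof.
have T0 : tau n (expR s) 0 != 0 by rewrite tau0// gt_eqF ?expR_gt0.
rewrite -(dsol0 m).
exact: is_derive_cvg_right0 (is_derive_scalel a (is_derive_sol n0 m T0)).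
Qed.

End Potential.
Arguments cvg_sol_right {R n} s n0 m a.

(** * Spectrum and heat coefficients *)

(** By induction the [i]-th value of [l1] occurs in [l2] at some index at least [i]: passing to the
    next value of [l1] strictly raises that index. *)
Lemma increasing_range_le (R : realType) (l1 l2 : nat -> R) :
  {homo l1 : i j / (i < j)%N >-> i < j} ->
  {homo l2 : i j / (i < j)%N >-> i < j} ->
  range l1 `<=` range l2 -> forall i, l2 i <= l1 i.
Proof.
move=> h1 h2 sub i.
have m2 : {mono l2 : i j / (i <= j)%N >-> i <= j} by exact: le_mono.
suff [k ik <-] : exists2 k, (i <= k)%N & l2 k = l1 i by rewrite m2.
elim: i => [|i [k ik kE]].
  by have [|k _ kE] := sub (l1 0%N); [exists 0%N | exists k].
have [|k' _ kE'] := sub (l1 i.+1); first by exists i.+1.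
exists k' => //; apply: leq_ltn_trans ik _.
rewrite ltnNge -m2 kE kE' -ltNge.
exact: h1.
Qed.

Lemma is_spectrum_unique (R : realType) (q : R -> R) (l1 l2 : nat -> R) :
  is_spectrum q l1 -> is_spectrum q l2 -> l1 = l2.
Proof.
move=> [h1 r1] [h2 r2]; apply/funext => i; apply/eqP; rewrite eq_le.
by rewrite !increasing_range_le// r1 r2.
Qed.

Section UnitIntervalIntegrals.
Context {R : realType}.
Implicit Types f : R -> R.

(** Expand the nonnegative integral of [(f - I) ^+ 2], where [I] is the mean of [f]. *)
Lemma Rintegral01_sqr_le f : cont01 f ->
  (\int[mu]_(x in `[(0 : R), 1]) f x) ^+ 2 <=
    \int[mu]_(x in `[(0 : R), 1]) (f x ^+ 2).
Proof.
move=> cf; set I := \int[mu]_(x in _) f x.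
have cf2 : cont01 (fun x => f x ^+ 2) by exact: (cont01M cf cf).
have cI := cont01_cst (I ^+ 2).
have cfI := cont01M (cont01_cst (2 * I)) cf.
have [i1 i2 i3] := And3 (cont01_integrable cf2) (cont01_integrable cfI)
  (cont01_integrable cI).
have i12 := cont01_integrable (cont01B cf2 cfI).
have : 0 <= \int[mu]_(x in `[(0 : R), 1]) ((f x ^+ 2 - 2 * I * f x) + I ^+ 2).
  apply: Rintegral_ge0 => x _.
  by rewrite (_ : _ + _ = (f x - I) ^+ 2) ?sqr_ge0//; ring.
rewrite RintegralD// RintegralB// RintegralZl//; last exact: cont01_integrable.
rewrite Rintegral_cst//= lebesgue_measure_itv/= lte_fin ltr01 /=.
by rewrite oppr0 addr0 mulr1 -/I => H; lra.
Qed.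

(** The primitive of [f] is nondecreasing and vanishes at both ends, so it is zero, and so is its
    derivative. *)
Lemma Rintegral01_eq0 f : cont01 f -> (forall x, x \in `]0, 1[ -> 0 <= f x) ->
  \int[mu]_(x in `[(0 : R), 1]) f x = 0 -> {in `]0, 1[, f =1 cst 0}.
Proof.
move=> cf f_ge0 f0 x x01.
have D := diff01_primitive cf; set F := fun x : R => _ in D.
have F0 : F 0 = 0 by rewrite /F set_itv1 Rintegral_set1.
have FE y : y \in `]0, 1[ -> F y = 0.
  rewrite in_itv/= => /andP[/ltW y0 /ltW y1]; apply/eqP; rewrite eq_le.
  have -> : F y <= 0.
    by rewrite -f0; exact: (diff01_incr D f_ge0 y0 y1 (lexx _)).
  by rewrite -F0; exact: (diff01_incr D f_ge0 (lexx _) y0 y1).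
have F'x := D.2 x x01.
have e : \forall y \near x, F y = cst 0 y by apply: (near01 x01) => y /FE.
by have := near_eq_derive (1 : R) e; rewrite derive_val derive_cst.
Qed.

End UnitIntervalIntegrals.

(** * Eigenvalues, normalized eigenfunctions and heat coefficients of [gamma n s] *)

Section Spectrum.
Context {R : realType}.
Variables (n : nat) (s : R).
Hypotheses (n0 : (0 < n)%N) (s0 : 0 <= s).

Let E1 : 1 <= expR s. Proof. by rewrite -expR0 ler_expR. Qed.

Definition sol_sqnorm m : R :=
  \int[mu]_(x in `[(0 : R), 1]) (sol n (expR s) m x ^+ 2).

Lemma cont01_sol m : cont01 (sol n (expR s) m).
Proof. by have [] := diff01_sol n0 s0 m. Qed.
Arguments cont01_sol m : clear implicits.

(** A zero norm would make [sol] vanish on the open interval, whereas its right derivative at 0 is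
    [freq m.+1]. *)
Lemma sol_sqnorm_gt0 m : 0 < sol_sqnorm m.+1.
Proof.
rewrite lt_neqAle Rintegral_ge0 ?andbT => [|x _]; last exact: sqr_ge0.
apply/eqP => /esym.
move=> /(Rintegral01_eq0 (cont01M (cont01_sol _) (cont01_sol _)))sqr0.
have z0 : {in `]0, 1[, sol n (expR s) m.+1 =1 cst 0}.
  move=> x x01; apply/eqP; rewrite -sqrf_eq0; apply/eqP; apply: sqr0 => // y _.
  exact: sqr_ge0.
have := cvg_sol_right s n0 m.+1 1.
set g := fun h : R => _ => gcvg.
have : g h @[h --> 0^'+] --> (0 : R).
  apply: cvg_near_cst; near=> h.
  rewrite /g !mul1r sol0// z0 ?subrr ?mulr0//.
  rewrite in_itv/=; apply/andP; split; near: h; [exact: nbhs_right_gt|].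
  exact: nbhs_right_lt.
move=> gcvg0.
have : 1 * freq m.+1 = 0 :> R by exact: (norm_cvg_unique gcvg gcvg0).
by apply/eqP; rewrite mul1r gt_eqF ?freq_gt0.
Unshelve. all: by end_near. Qed.

Lemma is_spectrum_gamma : is_spectrum (gamma n s) (fun j => freq j.+1 ^+ 2).
Proof.
split.
  move=> i j ij; rewrite ltrXn2r// ?mulr_ge0 ?pi_ge0//.
  by rewrite ltr_pM2r ?pi_gt0// ltr_nat.
apply/seteqP; split=> [_ [j _ <-]|l [u [/(schrodinger_gamma n0 s0)]]] /=.
  exists (sol n (expR s) j.+1); split.
    have := schrodinger_sol n0 s0 j.+1 1.
    under eq_fun do rewrite mul1r.
    by under [in X in schrodinger _ _ X]eq_fun do rewrite mul1r.
  apply: contrapT => z; have := sol_sqnorm_gt0 j.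
  rewrite /sol_sqnorm; under eq_Rintegral => x x01.
    rewrite (_ : sol n (expR s) j.+1 x = 0); last first.
      apply: contrapT => /eqP sx; apply: z; exists x => //.
      by move: x01; rewrite inE.
    over.
  by rewrite expr0n /= Rintegral_cst//= mul0r ltxx.
move=> [m [a [uE [->|a0]]]] [x x01]; first by exists m.
by rewrite uE// a0 mul0r eqxx.
Qed.

(** In the choice made by [lambda], existence of a spectrum excludes the default value and
    uniqueness identifies the result. *)
Lemma lambda_gamma : lambda (gamma n s) = fun j => freq j.+1 ^+ 2.
Proof.
have := @xgetPex _ (fun=> 0) [set l | is_spectrum (gamma n s) l]
  (ex_intro _ _ is_spectrum_gamma).
move=> H; exact: is_spectrum_unique H is_spectrum_gamma.
Qed.

Lemma ex_normalized_sol m : exists u,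
  is_normalized_eigenfunction (gamma n s) (freq m.+1 ^+ 2) u.
Proof.
have N0 := sol_sqnorm_gt0 m.
pose a := (Num.sqrt (sol_sqnorm m.+1))^-1.
exists (fun x => a * sol n (expR s) m.+1 x); split.
- exact: schrodinger_sol.
- under eq_Rintegral do rewrite exprMn.
  rewrite RintegralZl//; last first.
    exact: (cont01_integrable (cont01M (cont01_sol _) (cont01_sol _))).
  by rewrite -/(sol_sqnorm _) /a exprVn sqr_sqrtr ?(ltW N0)// mulVf// gt_eqF.
- exists (a * freq m.+1); last exact: cvg_sol_right.
  by rewrite mulr_gt0 ?freq_gt0// invr_gt0 sqrtr_gt0.
Qed.

(** Index [j] belongs to frequency [freq j.+1]. The quotient is invariant under rescaling of [sol],
    so neither norm nor sign has to be fixed. *)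
Definition heat_coef j :=
  (\int[mu]_(x in `[(0 : R), 1]) sol n (expR s) j.+1 x) ^+ 2 / sol_sqnorm j.+1.

(** Whatever eigenfunction [phi] selects is [a * sol] for some mode. Its norm gives [a ^+ 2] and
    excludes [a = 0], so the eigenvalue identifies the mode; only [a ^+ 2] enters the result. *)
Lemma phi_gamma_integral_sqr j :
  (\int[mu]_(x in `[(0 : R), 1]) phi (gamma n s) j x) ^+ 2 = heat_coef j.
Proof.
have [] : is_normalized_eigenfunction (gamma n s) (freq j.+1 ^+ 2)
    (phi (gamma n s) j).
  rewrite /phi lambda_gamma; exact: xgetPex (ex_normalized_sol j).
set u := phi _ _ => /(schrodinger_gamma n0 s0)[m [a [uE le]]] u1 _.
have uE' : {in `[(0 : R), 1]%classic,
    forall x, u x = a * sol n (expR s) m.+1 x}.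
  by move=> x; rewrite inE; exact: uE.
have am : a ^+ 2 * sol_sqnorm m.+1 = 1.
  rewrite -u1 -RintegralZl//; last first.
    exact: (cont01_integrable (cont01M (cont01_sol _) (cont01_sol _))).
  by apply: eq_Rintegral => x /uE' ->; rewrite exprMn.
have mj : m.+1 = j.+1.
  case: le => [/eqP|a0]; last first.
    by move: am; rewrite a0 expr0n mul0r => /eqP; rewrite eq_sym oner_eq0.
  by rewrite eqrXn2// ?mulr_ge0 ?pi_ge0// => /eqP /freq_inj.
rewrite mj in uE' am.
under eq_Rintegral => x x01 do rewrite uE'//.
rewrite RintegralZl//; last exact: (cont01_integrable (cont01_sol _)).
rewrite exprMn /heat_coef.
have N0 := lt0r_neq0 (sol_sqnorm_gt0 j).
by apply: (mulIf N0); rewrite mulrAC am mul1r divfK.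
Qed.

Lemma heat_coef_ge0 j : 0 <= heat_coef j.
Proof. by rewrite divr_ge0 ?sqr_ge0// ltW// sol_sqnorm_gt0. Qed.

Lemma heat_coef_le1 j : heat_coef j <= 1.
Proof.
rewrite ler_pdivrMr ?sol_sqnorm_gt0// mul1r Rintegral01_sqr_le//.
exact: cont01_sol.
Qed.

Lemma heat_content_gamma t : heat_content (gamma n s) t =
  limn (series (fun j => expR (- t * freq j.+1 ^+ 2) * heat_coef j)).
Proof.
rewrite /heat_content; congr (limn (series _)); apply/funext => j.
by rewrite phi_gamma_integral_sqr lambda_gamma.
Qed.

(** Index [n.-1] is the mode of frequency [freq n]. With [E = expR s], its solution is
    [E * sn n / tau n E], of squared norm [E / 2]. *)
Lemma heat_coef_n : heat_coef n.-1 =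
  2 * expR s * (\int[mu]_(x in `[(0 : R), 1]) (sn n x / tau n (expR s) x)) ^+ 2.
Proof.
have T0 x : x \in `[0, 1] -> tau n (expR s) x != 0.
  by move=> x01; exact/lt0r_neq0/tau_gt0.
have solE : {in `[(0 : R), 1]%classic, forall x, sol n (expR s) n x =
    expR s * (sn n x / tau n (expR s) x)}.
  move=> x; rewrite inE => /= /T0 t0.
  transitivity ((tau n (expR s) x + 2 * (expR s - 1) * prim n n x)
      * (sn n x / tau n (expR s) x)); last by rewrite /tau subrK.
  by rewrite /sol; field.
have [cS _] := @diff01_sn R n.
have [cT _] := diff01_tauV n0 E1.
have cST := cont01M cS cT.
rewrite /heat_coef prednK// /sol_sqnorm.
under eq_Rintegral => x x01 do rewrite solE//.
rewrite RintegralZl//; last first.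
  exact: cont01_integrable.
have -> : \int[mu]_(x in `[(0 : R), 1]) (sol n (expR s) n x ^+ 2) = expR s / 2.
  have D := diff01Z (expR s) (diff01_prim_tauV n0 E1).
  have cD := cont01M (cont01_cst (expR s))
    (cont01M (cont01_cst (expR s)) (cont01M cST cST)).
  have := Rintegral_diff01 D cD (lexx _) ler01 (lexx _).
  rewrite prim1// tau1// prim0 mul0r mulr0 subr0 divr1 => <-.
  by apply: eq_Rintegral => x /solE ->; ring.
by field; rewrite gt_eqF ?expR_gt0.
Qed.

End Spectrum.

(** * Uniqueness of Dirichlet series *)

Section DirichletSeries.
Context {R : realType}.
Variable l : nat -> R.
Hypotheses (l0 : 0 <= l 0%N) (lD : forall j k, l j + k%:R <= l (j + k)%N).

(** Exponents growing by at least one per index bound everything after the [j]-th term by a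
    geometric series of ratio [expR (- t)]. *)
Let term_le t j k : 0 < t ->
  expR (- t * l (j + k)%N) <= expR (- t * l j) * expR (- t) ^+ k.
Proof.
move=> t0; rewrite -expRM_natl -expRD ler_expR -mulr_natl.
by rewrite (_ : _ + _ = - t * (l j + k%:R)) ?ler_nM2l ?oppr_lt0//; ring.
Qed.

Let expRN_lt1 (t : R) : 0 < t -> expR (- t) < 1.
Proof. by move=> t0; rewrite -expR0 ltr_expR oppr_lt0. Qed.

Lemma is_cvg_dirichlet_series (c : nat -> R) t : 0 < t ->
  (forall j, 0 <= c j <= 1) ->
  cvgn (series (fun j => expR (- t * l j) * c j)).
Proof.
move=> t0 c01; apply: (@series_le_cvg _ _ (geometric 1 (expR (- t)))).
- by move=> j; rewrite mulr_ge0 ?expR_ge0//; case/andP: (c01 j).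
- by move=> j /=; rewrite mulr_ge0// exprn_ge0// expR_ge0.
- move=> j /=; have /andP[c0 c1] := c01 j.
  rewrite -[leRHS]mulr1 ler_pM ?expR_ge0//.
  apply: le_trans (term_le 0 j t0) _; rewrite ler_wpM2r ?exprn_ge0 ?expR_ge0//.
  by rewrite -expR0 ler_expR mulNr oppr_le0 mulr_ge0// ltW.
- by apply: is_cvg_geometric_series; rewrite ger0_norm ?expR_ge0// expRN_lt1.
Qed.

Lemma dirichlet_series_head_le (e : nat -> R) t j N : 0 < t ->
  (forall i, `|e i| <= 1) -> (forall i, (i < j)%N -> e i = 0) ->
  `|series (fun i => expR (- t * l i) * e i) (j + N.+1)%N
      - expR (- t * l j) * e j|
    <= expR (- t * l j) * (expR (- t) / (1 - expR (- t))).
Proof.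
move=> t0 e1 ej; set x := expR (- t); set u := fun i => _.
have x1 : 0 < 1 - x by rewrite subr_gt0 expRN_lt1.
(* The induction carries the exact value of the geometric sum from [x] to [x ^+ N]; the stated bound
   drops its last correction. *)
suff H : `|series u (j + N.+1)%N - u j| <=
    expR (- t * l j) * ((x - x ^+ N.+1) / (1 - x)).
  apply: (le_trans H); rewrite ler_wpM2l ?expR_ge0//.
  rewrite ler_wpM2r ?invr_ge0 ?(ltW x1)//.
  by rewrite gerBl exprn_ge0// expR_ge0.
elim: N => [|N IH].
  rewrite addn1 seriesSr seriesEnat /= big_nat big1 => [|i /= ij]; last first.
    by rewrite /u ej// mulr0.
  by rewrite add0r subrr normr0 expr1 subrr mul0r mulr0.
rewrite addnS seriesSr.
rewrite addrAC (le_trans (ler_normD _ _))//.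
have -> : (x - x ^+ N.+2) / (1 - x) = (x - x ^+ N.+1) / (1 - x) + x ^+ N.+1.
  by rewrite [x ^+ N.+2]exprS; field; exact: lt0r_neq0.
rewrite mulrDr lerD// normrM ger0_norm ?expR_ge0//.
rewrite -[leRHS]mulr1 ler_pM ?expR_ge0//; exact: term_le.
Qed.

(** Strong induction on [j]: once the earlier coefficients vanish, the [j]-th term dominates for
    large [t]. The limit 0 gives a bound on [e j] that tends to 0 as [t] grows. *)
Lemma dirichlet_series_eq0 (e : nat -> R) : (forall i, `|e i| <= 1) ->
  (forall t, 0 < t -> series (fun i => expR (- t * l i) * e i) @ \oo --> 0) ->
  forall j, e j = 0.
Proof.
move=> e1 S0 j; elim/ltn_ind: j => j ej.
apply/eqP; rewrite -normr_le0; apply/ler_addgt0Pr => r r0; rewrite add0r.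
(* The solution of [x / (1 - x) = r]; the time [t] is then chosen with [expR (- t) = x]. *)
pose x := r / (1 + r).
have r1 : 0 < 1 + r by rewrite addr_gt0.
have x0 : 0 < x by rewrite divr_gt0.
have x1 : x < 1 by rewrite ltr_pdivrMr// mul1r ltrDr.
pose t := - ln x.
have t0 : 0 < t by rewrite oppr_gt0 ln_lt0// x0.
have ext : expR (- t) = x by rewrite opprK lnK.
have xr : x / (1 - x) = r by rewrite /x; field; rewrite ?gt_eqF//; lra.
have := S0 t t0; set u := fun i => _; rewrite -(cvg_shiftn j.+1) => S0t.
have : `|series u (n + j.+1)%N - u j| @[n --> \oo] --> `|0 - u j|.
  by apply: cvg_norm; apply: cvgB => //; exact: cvg_cst.
move=> /cvgr_to_le H.
have {}H : `|0 - u j| <= expR (- t * l j) * r.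
  apply: H; near=> n; rewrite -addSnnS addnC -xr -ext.
  exact: dirichlet_series_head_le.
move: H; rewrite sub0r normrN /u normrM ger0_norm ?expR_ge0//.
by rewrite ler_pM2l ?expR_gt0.
Unshelve. all: by end_near. Qed.

Lemma dirichlet_series_inj (c d : nat -> R) :
  (forall j, 0 <= c j <= 1) -> (forall j, 0 <= d j <= 1) ->
  (forall t, 0 < t -> limn (series (fun j => expR (- t * l j) * c j)) =
                      limn (series (fun j => expR (- t * l j) * d j))) ->
  forall j, c j = d j.
Proof.
move=> c01 d01 cd j; apply/eqP; rewrite -subr_eq0; apply/eqP.
apply: (@dirichlet_series_eq0 (fun j => c j - d j)) => [i|t t0].
  have /andP[c0 c1] := c01 i; have /andP[d0 d1] := d01 i.
  by rewrite ler_norml; lra.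
have cc := is_cvg_dirichlet_series t0 c01.
have cd' := is_cvg_dirichlet_series t0 d01.
have := lim_seriesB cc cd'; rewrite cd// subrr => <-.
rewrite (_ : (fun i => _) = (fun j => expR (- t * l j) * c j) -
  (fun j => expR (- t * l j) * d j)); first exact: is_cvg_seriesB.
by apply/funext => i; rewrite mulrBr.
Qed.

End DirichletSeries.

(** * The coefficient of the deformed mode *)

Section Coefficient.
Context {R : realType}.
Variables (n : nat).
Hypotheses (n0 : (0 < n)%N).
Implicit Types (s x : R).

(** Both heat contents are Dirichlet series with the same exponents [freq j.+1 ^+ 2], whose gaps
    exceed the required size because [pi ^+ 2 >= 1]. *)
Lemma isoheat_heat_coef s s' j : 0 <= s -> 0 <= s' ->
  isoheat (gamma n s) (gamma n s') -> heat_coef n s j = heat_coef n s' j.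
Proof.
move=> s0 s'0 H; apply: (@dirichlet_series_inj _ (fun j => freq j.+1 ^+ 2)).
- exact: sqr_ge0.
- move=> i k; have p1 : 1 <= (pi : R) ^+ 2.
    by rewrite exprn_ege1// (le_trans _ (pi_ge2 R))// ler1n.
  have i1 : (1 : R) <= i.+1%:R by rewrite ler1n.
  have k0 : (0 : R) <= k%:R by exact: ler0n.
  rewrite /freq !exprMn -addSn natrD -subr_ge0.
  rewrite (_ : _ - _ = k%:R * (pi ^+ 2 * (2 * i.+1%:R + k%:R) - 1)).
    by rewrite mulr_ge0// subr_ge0; nra.
  by ring.
- by move=> i; rewrite (heat_coef_ge0 n0 s0) (heat_coef_le1 n0 s0).
- by move=> i; rewrite (heat_coef_ge0 n0 s'0) (heat_coef_le1 n0 s'0).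
- move=> t t0.
  exact: (etrans (esym (heat_content_gamma n0 s0 t))
    (etrans (H t t0) (heat_content_gamma n0 s'0 t))).
Qed.

Definition mean_psi E : R := \int[mu]_(x in `[(0 : R), 1]) (sn n x / tau n E x).

Lemma isoheat_mean_psi s s' : 0 <= s -> 0 <= s' ->
  isoheat (gamma n s) (gamma n s') ->
  expR s * mean_psi (expR s) ^+ 2 = expR s' * mean_psi (expR s') ^+ 2.
Proof.
move=> s0 s'0 /(isoheat_heat_coef n.-1 s0 s'0).
rewrite (heat_coef_n n0 s0) (heat_coef_n n0 s'0) -!mulrA => /mulfI; apply.
by rewrite pnatr_eq0.
Qed.

Let wn0 : freq n != 0 :> R. Proof. exact/lt0r_neq0/freq_gt0. Qed.

(** The primitive of [sn n] vanishing at 0. It is nonnegative, and for even [n] it also vanishes at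
    1. *)
Let F x : R := (freq n)^-1 * (1 - cs n x).

Let FD : diff01 F (sn n).
Proof.
have := diff01Z (freq n)^-1 (diff01B (diff01_cst 1) (@diff01_cs R n)).
by apply: diff01_eqr => x _; rewrite sub0r opprK mulrA mulVf ?mul1r.
Qed.

Lemma mean_psi1 : mean_psi 1 = (1 - (-1) ^+ n) / freq n.
Proof.
have [cS _] := @diff01_sn R n.
rewrite /mean_psi.
under eq_Rintegral do rewrite /tau subrr mulr0 mul0r subr0 divr1.
rewrite (Rintegral_diff01 FD cS (lexx _) ler01 (lexx _)).
by rewrite /F cs0 /cs mulr1 cos_freq subrr mulr0 subr0 mulrC.
Qed.

(** Integration by parts against [F] has no boundary terms for even [n]. A zero mean would force the
    nonnegative product of [F] and the derivative [h] of [1 / tau] to vanish on the open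
    interval. *)
Lemma mean_psi_even E : ~~ odd n -> 1 < E -> mean_psi E != 0.
Proof.
move=> n_even E1; apply/eqP => I0.
have TD := diff01_tauV n0 (ltW E1).
have [[cF _] [cS _] [cT _]] := And3 FD (@diff01_sn R n) TD.
have cST := cont01M cS cT.
set h := fun x => 2 * (E - 1) * sn n x ^+ 2 / tau n E x ^+ 2 in TD.
have ch : cont01 h.
  have := cont01M (cont01_cst (2 * (E - 1))) (cont01M cST cST).
  by apply: cont01_eq => x _; rewrite /h -exprVn; ring.
have cFh := cont01M cF ch.
have F1 : F 1 = 0.
  by rewrite /F /cs mulr1 cos_freq -signr_odd (negbTE n_even) subrr mulr0.
have F0 : F 0 = 0 by rewrite /F cs0 subrr mulr0.
have := Rintegral_diff01 (diff01M FD TD) (cont01D cST cFh)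
  (lexx _) ler01 (lexx _).
rewrite F1 F0 !mul0r subrr RintegralD//; try exact: cont01_integrable.
rewrite -/(mean_psi E) I0 add0r => Fh_int.
have h_ge0 x : 0 <= h x.
  apply: divr_ge0; last exact: sqr_ge0.
  apply: mulr_ge0; last exact: sqr_ge0.
  by apply: mulr_ge0 => //; rewrite subr_ge0 ltW.
have F_ge0 x : 0 <= F x.
  apply: mulr_ge0; last by rewrite subr_ge0 cos_le1.
  by rewrite invr_ge0; exact/ltW/freq_gt0.
have Fh0 := Rintegral01_eq0 cFh
  (fun x _ => mulr_ge0 (F_ge0 x) (h_ge0 x)) Fh_int.
(* Here [freq n * x] is [pi / 2], so [sn n x = 1], [cs n x = 0], and both factors are positive. *)
pose x : R := (2 * n%:R)^-1.
have n1 : (1 : R) <= n%:R by rewrite ler1n.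
have x01 : x \in `]0, 1[.
  have n2 : (0 : R) < 2 * n%:R by lra.
  by rewrite in_itv/= /x invr_gt0 n2 invf_lt1//; lra.
have fx : freq n * x = pi / 2 by rewrite /freq /x; field; lra.
have := Fh0 x x01; apply/eqP/lt0r_neq0.
have T0 : 0 < tau n E x by apply: tau_gt0 => //; [exact: ltW | exact: in01].
rewrite /F /h /cs /sn fx cos_pihalf sin_pihalf expr1n.
rewrite subr0 !mulr1; apply: mulr_gt0; first by rewrite invr_gt0 freq_gt0.
apply: divr_gt0; last exact: exprn_gt0.
by apply: mulr_gt0 => //; rewrite subr_gt0.
Qed.

(** Equality would make [prim n n] constant between [x] and 1, hence [sn n] zero there, hence [cs n]
    zero too, contradicting the Pythagorean identity. *)
Lemma prim_lt_half x : 0 <= x -> x < 1 -> prim n n x < 2^-1.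
Proof.
move=> x0 x1; rewrite -(@prim1 R n) lt_neqAle prim_incr ?(ltW x1)// andbT.
apply/eqP => px.
have x01 y : y \in `]x, 1[ -> y \in `]0, 1[.
  by rewrite !in_itv/= => /andP[/(le_lt_trans x0)-> ->].
have pE y : y \in `]x, 1[ -> prim n n y = prim n n 1.
  rewrite in_itv/= => /andP[/ltW xy /ltW y1].
  apply/eqP; rewrite eq_le prim_incr//=; last exact: le_trans xy.
  by rewrite -px prim_incr.
have near_x1 y (P : R -> Prop) : y \in `]x, 1[ ->
    (forall z, z \in `]x, 1[ -> P z) -> \forall z \near y, P z.
  by move=> yx1 H; near=> z; apply: H; near: z; exact: near_in_itvoo.
have sE y : y \in `]x, 1[ -> sn n y = 0 :> R.
  move=> yx1; have e : \forall z \near y, prim n n z = cst (prim n n 1) z.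
    by apply: (near_x1 y) => // z /pE.
  have D := is_derive_prim n0 n y.
  have := near_eq_derive (1 : R) e; rewrite derive_val derive_cst.
  by move=> /eqP; rewrite mulf_eq0 orbb => /eqP.
pose y := (x + 1) / 2.
have yx1 : y \in `]x, 1[ by rewrite in_itv/= /y; lra.
have e : \forall z \near y, sn n z = cst 0 z by apply: (near_x1 y) => // z /sE.
have D := is_derive_sn n y.
have := near_eq_derive (1 : R) e; rewrite derive_val derive_cst => /eqP.
rewrite mulf_eq0 (negbTE wn0) /= => /eqP c0.
have := cs2Dsn2 n y; rewrite c0 sE// expr0n addr0 => /eqP.
by rewrite eq_sym oner_eq0.
Unshelve. all: by end_near. Qed.

(** Split the integral at [1 - d]. To the left [tau] is at least a fixed multiple of [E = r ^+ 2],
    giving the first term; to the right, weighted AM-GM and the known norm of the mode give the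
    other two. *)
Lemma mean_psi_le (r e d : R) : 1 <= r -> 0 < e -> 0 < d -> d < 1 ->
  r * `|mean_psi (r ^+ 2)| <=
    (r * (1 - 2 * prim n n (1 - d)))^-1 + e / 4 + d / (2 * e).
Proof.
move=> r1 e0 d0 d1; set E := r ^+ 2.
have r0 : 0 < r by exact: lt_le_trans r1.
have E1 : 1 <= E by rewrite exprn_ege1.
have [cS _] := @diff01_sn R n.
have [cT _] := diff01_tauV n0 E1.
have cST := cont01M cS cT.
have PD := diff01_primitive cST.
set P := fun x : R => _ in PD.
have P0 : P 0 = 0 by rewrite /P set_itv1 Rintegral_set1.
rewrite -[mean_psi E]/(P 1).
set g := 1 - _.
have [dl dr] : 0 <= 1 - d /\ 1 - d <= 1 by lra.
have g0 : 0 < g.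
  have : prim n n (1 - d) < 2^-1 by apply: prim_lt_half; lra.
  by rewrite /g; lra.
have K0 : 0 <= prim n n (1 - d) by rewrite -(@prim0 R n n) prim_incr.
have T0 x : x \in `[0, 1] -> 0 < tau n E x by exact: tau_gt0.
have near0 : r * `|P (1 - d)| <= (r * g)^-1.
  pose M := (E * g)^-1.
  have tM z : z \in `]0, 1 - d[ -> `|sn n z / tau n E z| <= M.
    rewrite in_itv/= => /andP[/ltW z0 /ltW zd].
    have z01 : z \in `[0, 1] by rewrite in_itv/= z0; lra.
    (* By monotonicity it suffices to look at [1 - d], where [tau] equals
       [E * g + 2 * prim n n (1 - d)]. *)
    have tz : E * g <= tau n E z.
      apply: le_trans (tau_decr n0 E1 z0 zd dr).
      by rewrite /tau /g; nra.
    rewrite normrM normfV (gtr0_norm (T0 z z01)) /M.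
    rewrite -[leRHS]mul1r ler_pM ?invr_ge0 ?(ltW (T0 z z01))// ?sin_max//.
    by rewrite lef_pV2// posrE ?T0// mulr_gt0// exprn_gt0.
  have MD := diff01Z M (diff01_everywhere (fun x _ => is_derive_id x 1)).
  have Ple : `|P (1 - d)| <= M.
    have M0 : 0 <= M by rewrite invr_ge0 mulr_ge0 ?ltW// exprn_gt0.
    have := diff01_incr_in (diff01B MD PD) (lexx _) dl dr.
    have := diff01_incr_in (diff01D MD PD) (lexx _) dl dr.
    rewrite /= P0 mulr0 addr0 subr0 mulr1 => H1 H2.
    have {}H1 : 0 <= M * (1 - d) + P (1 - d).
      by apply: H1 => z /tM; rewrite ler_norml => /andP[]; lra.
    have {}H2 : 0 <= M * (1 - d) - P (1 - d).
      by apply: H2 => z /tM; rewrite ler_norml => /andP[]; lra.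
    by rewrite ler_norml; apply/andP; split; nra.
  apply: le_trans (ler_wpM2l (ltW r0) Ple) _.
  by rewrite /M /E le_eqVlt; apply/orP; left; apply/eqP; field; rewrite ?gt_eqF.
have near1 : r * `|P 1 - P (1 - d)| <= e / 4 + d / (2 * e).
  (* [Q] is a primitive of the AM-GM majorant below, so [Q - r * P] and [Q + r * P] are
     nondecreasing. *)
  have QD := diff01D (diff01Z (e / 2) (diff01_prim_tauV n0 E1))
    (diff01Z (2 * e)^-1 (diff01_everywhere (fun x _ => is_derive_id x 1))).
  set Q := fun x : R => _ in QD.
  (* AM-GM: [2 r |sn / tau| <= e r^2 (sn / tau)^2 + 1 / e] *)
  have amgm (y : R) : `|r * y| <= e / 2 * (E * y ^+ 2) + (2 * e)^-1 * 1.
    have H (z : R) : r * z <= e / 2 * (E * z ^+ 2) + (2 * e)^-1 * 1.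
      rewrite -subr_ge0 (_ : _ - _ = (e * r * z - 1) ^+ 2 / (2 * e)); last first.
        by rewrite /E; field; rewrite gt_eqF.
      by rewrite divr_ge0 ?sqr_ge0// mulr_ge0// ltW.
    by rewrite ler_norml H andbT lerNl -mulrN -[y ^+ 2]sqrrN H.
  have Hp : Q (1 - d) - r * P (1 - d) <= Q 1 - r * P 1.
    apply: (diff01_incr_in (diff01B QD (diff01Z r PD))) => // z _.
    by rewrite subr_ge0 (le_trans (ler_norm _))// amgm.
  have Hm : Q (1 - d) + r * P (1 - d) <= Q 1 + r * P 1.
    apply: (diff01_incr_in (diff01D QD (diff01Z r PD))) => // z _.
    have := amgm (sn n z / tau n E z); rewrite ler_norml => /andP[+ _].
    by rewrite -subr_ge0 opprK addrC.
  have QE : Q 1 - Q (1 - d) <= e / 4 + d / (2 * e).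
    have : 0 <= prim n n (1 - d) / tau n E (1 - d).
      by rewrite divr_ge0// ltW// T0// in_itv/= dl.
    rewrite /Q prim1// tau1//; set k := _ / _ => k0.
    rewrite [(2 * e)^-1 * _]mulrC [(2 * e)^-1 * (1 - d)]mulrC.
    set w := (2 * e)^-1.
    by rewrite -/w; nra.
  rewrite -{1}(gtr0_norm r0) -normrM mulrBr ler_norml.
  by apply/andP; split; lra.
rewrite -[P 1](subrK (P (1 - d))) addrC.
have := ler_normD (P (1 - d)) (P 1 - P (1 - d)).
rewrite -(ler_pM2l r0) mulrDr => H; lra.
Qed.

(** With [A = mean_psi 1], the parameters are chosen so that each of the three terms of
    [mean_psi_le] is at most [A / 4]. *)
Lemma mean_psi_odd : odd n -> exists2 r : R, 1 <= r &
  r * `|mean_psi (r ^+ 2)| < mean_psi 1.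
Proof.
move=> n_odd; pose A : R := 2 / freq n.
have A1 : mean_psi 1 = A by rewrite mean_psi1 -signr_odd n_odd expr1 opprK.
have f2 : 2 <= freq n :> R.
  rewrite /freq (le_trans (pi_ge2 R))// ler_peMl ?pi_ge0// ler1n//.
have A0 : 0 < A by rewrite divr_gt0// freq_gt0.
have Ale1 : A <= 1 by rewrite ler_pdivrMr ?mul1r// freq_gt0.
(* With [e = A] this gives [d / (2 * e) = A / 4]; [A <= 1] ensures [d < 1]. *)
pose d := A ^+ 2 / 2.
have d0 : 0 < d by rewrite divr_gt0// exprn_gt0.
have d1 : d < 1 by rewrite /d; nra.
set g := 1 - 2 * prim n n (1 - d).
have g0 : 0 < g.
  have : prim n n (1 - d) < 2^-1 by apply: prim_lt_half; lra.
  by rewrite /g; lra.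
(* Then [r * g = g + 4 / A], which exceeds [4 / A]. *)
pose r := 1 + 4 / (A * g).
have r1 : 1 <= r by rewrite lerDl divr_ge0// mulr_ge0// ltW.
exists r => //; rewrite A1; apply: le_lt_trans (mean_psi_le r1 A0 d0 d1) _.
have -> : d / (2 * A) = A / 4 by rewrite /d; field; rewrite gt_eqF.
suff : (r * g)^-1 <= A / 4 by lra.
have rg0 : 0 < r * g by rewrite mulr_gt0// (lt_le_trans ltr01).
rewrite invf_ple ?posrE//; last by rewrite divr_gt0// A0.
rewrite (_ : r * g = g + 4 / A); last by rewrite /r; field; rewrite !gt_eqF.
by rewrite invf_div; lra.
Qed.

End Coefficient.

Theorem theorem10 (R : realType) (n : nat) (hn : (0 < n)%N) :
  ~ (forall s : R, isoheat (gamma n s) (gamma n 0)).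
Proof.
move=> H; have [n_odd|n_even] := boolP (odd n).
  have [r r1 rlt] := @mean_psi_odd R n hn n_odd.
  have r0 : 0 < r by exact: lt_le_trans r1.
  (* The deformation parameter is [s = ln (r ^+ 2)], for which [expR s * mean_psi ^+ 2] is the
     square of [r * mean_psi]. *)
  have rE : expR (ln (r ^+ 2)) = r ^+ 2 by rewrite lnK// posrE exprn_gt0.
  have ln0 : 0 <= ln (r ^+ 2) by rewrite ln_ge0// exprn_ege1.
  have := isoheat_mean_psi hn ln0 (lexx _) (H (ln (r ^+ 2))).
  rewrite rE expR0 mul1r => e.
  have : (r * `|mean_psi n (r ^+ 2)|) ^+ 2 < mean_psi n 1 ^+ 2.
    by rewrite ltrXn2r// mulr_ge0// ltW.
  by rewrite exprMn real_normK ?num_real// e ltxx.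
(* For even [n] the parameter [s = 1] suffices: the undeformed mean is 0 and the deformed one is
   not. *)
have := isoheat_mean_psi hn ler01 (lexx _) (H 1).
rewrite expR0 mul1r mean_psi1// -signr_odd (negbTE n_even) subrr mul0r expr0n.
move=> /eqP; rewrite mulf_eq0 gt_eqF ?expR_gt0//= sqrf_eq0.
by apply/negP/mean_psi_even => //; rewrite -expR0 ltr_expR.
Qed.
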